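(* Let $\operatorname{char}\mathsf k=0$, and let $A=R/\operatorname{Ann}(F)$ be a graded Artinian complete intersection quotient of $R=\mathsf k[x,y]$ of Hilbert function $H(A)=(1,2,\ldots,d-1,d^k,d-1,\ldots,2,1)$ ($d$ occurring $k\ge1$ times), with socle degree $j=2d+k-3$. Let $\ell$ be a nonzero linear form and let $P_\ell=(p_1,p_2,\ldots,p_d,\ldots)$, $p_1\ge p_2\ge\cdots$, be its Jordan type partition on $A$. Then for each $i\in[0,d-1]$, $$h^i_\ell(F)\ne0\iff\sum_{u=1}^{i+1}p_u=(i+1)(2d+k-i-2)=(i+1)(j+1-i).$$ In particular, $P_\ell$ has $d$ parts unless $k\ge2$ and $h^{d-1}_\ell(F)=0$.
   Context: $\mathsf k$ is an infinite field; $R=\mathsf k[x,y]$ has the standard grading and acts on $\mathcal E=\mathsf k[X,Y]$ by differentiation ($x=\partial_X$, $y=\partial_Y$), written $f\circ F$. Every graded Artinian complete intersection quotient of $R$ of socle degree $j$ is $A=R/\operatorname{Ann}F$ with $F\in\mathcal E_j$, $\operatorname{Ann}F=\{f\in R: f\circ F=0\}$. The Hilbert function above is $H(A)_i=i+1$ for $0\le i\le d-1$, $d$ for $d-1\le i\le d+k-2$, $j+1-i$ for $d+k-2\le i\le j$. The Jordan type $P_\ell=P_{\ell,A}$ is the partition of $\dim_{\mathsf k}A$ given by the Jordan block sizes of multiplication by $\ell$ on $A$. For $0\le i\le d-1$, given a basis $(\alpha_1,\ldots,\alpha_{i+1})$ of $A_i$, the $i$-th Hessian is $h^i(F)=\det[\alpha_u\alpha_v\circ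 F]_{u,v}$, well defined up to a nonzero scalar; for $\ell=ax+by$, $h^i_\ell(F)$ is its value at $(X,Y)=(a,b)$ (nonzero iff multiplication by $\ell^{j-2i}:A_i\to A_{j-i}$ is an isomorphism). *)

(* Defs.v *)
From HB Require Import structures.
From mathcomp Require Import all_boot all_order all_algebra.
From mathcomp.multinomials Require Import ssrcomplements mpoly.

Set Implicit Arguments.
Unset Strict Implicit.
Unset Printing Implicit Defensive.

Import GRing.Theory.
Local Open Scope ring_scope.
Local Open Scope quotient_scope.

Section FinDim.
Variables (K : fieldType) (W W' : vectType K) (V : lmodType K).
Variables (g : {linear W -> V}) (g' : V -> W) (h : {linear V -> W'}).
Hypotheses (gK : cancel g' g) (h_inj : injective h).

(* A quotient of W that embeds in W' is finite dimensional. *)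
Let hg : 'Hom(W, W') := linfun (h \o g).
Let U := limg hg.

Lemma mem_himg v : h v \in U.
Proof. by rewrite -(gK v) -[h _]/((h \o g) _) -lfunE memv_img ?memvf. Qed.

Definition findim_fwd (v : V) : subvs_of U := Subvs (mem_himg v).

Lemma findim_fwd_linear : linear findim_fwd.
Proof. by move=> a u v; apply: val_inj; rewrite /= linearP. Qed.
HB.instance Definition _ :=
  GRing.isLinear.Build K V (subvs_of U) _ findim_fwd findim_fwd_linear.

Lemma findim_fwd_bij : bijective findim_fwd.
Proof.
pose bwd (x : subvs_of U) := g ((hg^-1)%VF (vsval x)).
have bK : cancel bwd findim_fwd.
  move=> x; apply: val_inj => /=.
  have := limg_lfunVK (subvsP x); rewrite /hg lfunE /=; exact.
exists bwd => // v; apply: h_inj.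
by have /(congr1 vsval) := bK (findim_fwd v).
Qed.

Import VectorInternalTheory.
Lemma findim_vect_axiom : Vector.axiom (dim (subvs_of U)) V.
Proof.
exists (v2r \o findim_fwd); first by move=> a u v; rewrite /= (linearP findim_fwd) linearP.
apply: bij_comp findim_fwd_bij; exists r2v; [exact: v2rK | exact: r2vK].
Qed.
End FinDim.

Section Contraction.
Variable K : fieldType.
Local Notation R := {mpoly K[2]}.
Implicit Types f g F : R.

(* f o F : the variables of f act on F as partial derivatives. *)
Definition contract f F : R := \sum_(m <- msupp f) f@_m *: F^`M[m].

Lemma contractE n f F : (msize f <= n)%N ->
  contract f F = \sum_(m : 'X_{1..2 < n}) f@_m *: F^`M[m].
Proof.
move=> le_n; rewrite /contract (big_mksub 'X_{1..2 < n}) //=.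
- by rewrite big_rmcond //= => m /memN_msupp_eq0 ->; rewrite scale0r.
- exact: msupp_uniq.
- by move=> m /msize_mdeg_lt /leq_trans; apply.
Qed.

Lemma contract_linearl F : linear (contract^~ F).
Proof.
move=> c f g; pose n := maxn (msize (c *: f + g)) (maxn (msize f) (msize g)).
rewrite !(@contractE n) ?leq_max ?leqnn ?orbT // scaler_sumr -big_split /=.
by apply: eq_bigr => m _; rewrite mcoeffD mcoeffZ scalerDl scalerA.
Qed.

Lemma contract_linearr f : linear (contract f).
Proof.
move=> c F G; rewrite /contract scaler_sumr -big_split /=.
by apply: eq_bigr => m _; rewrite linearP scalerDr !scalerA mulrC.
Qed.
HB.instance Definition _ f :=
  GRing.isLinear.Build K R R _ (contract f) (contract_linearr f).

Lemma contractX m F : contract 'X_[m] F = F^`M[m].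
Proof. by rewrite /contract msuppX big_seq1 mcoeffX eqxx scale1r. Qed.

Lemma contract1 F : contract 1 F = F.
Proof. by rewrite -mpolyX0 contractX mderivm0m. Qed.

Definition contractl F f := contract f F.
HB.instance Definition _ F :=
  GRing.isLinear.Build K R R _ (contractl F) (contract_linearl F).

Lemma contractM f g F : contract (f * g) F = contract f (contract g F).
Proof.
rewrite -[contract (f * g) F]/(contractl F (f * g)).
rewrite -[RHS]/(contractl (contract g F) f).
rewrite [f]mpolyE mulr_suml !linear_sum /=; apply: eq_bigr => m _.
rewrite -scalerAl !linearZ /=; congr (_ *: _).
rewrite [g in LHS]mpolyE mulr_sumr linear_sum /contractl contractX.
rewrite [contract g F]/contract linear_sum /=; apply: eq_bigr => m' _.
rewrite -scalerAr -mpolyXD linearZ linearZ /= /contractl contractX.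
by rewrite -mderivmDm addmC.
Qed.

Definition annihilator F (F_neq0 : F != 0) : {pred R} :=
  [pred f | contract f F == 0].

Lemma annihilator_idealr F (F_neq0 : F != 0) :
  idealr_closed (annihilator F_neq0).
Proof.
split=> [||a f g]; rewrite !inE.
- by rewrite -[contract _ _]/(contractl F 0) linear0.
- by rewrite contract1.
move=> /eqP f0 /eqP g0; rewrite -[contract _ _]/(contractl F (a * f + g)).
by rewrite linearD /= /contractl contractM f0 g0 addr0 linear0.
Qed.
HB.instance Definition _ F (F_neq0 : F != 0) :=
  isIdealr.Build R (annihilator F_neq0) (annihilator_idealr F_neq0).

End Contraction.

(* A = R / Ann F.  F != 0 is needed for Ann F to be a proper ideal. *)
Definition gorenstein (K : fieldType) (F : {mpoly K[2]}) (F_neq0 : F != 0) :=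
  {ideal_quot (annihilator F_neq0)}.

Section Algebra.
Variables (K : fieldType) (F : {mpoly K[2]}) (F_neq0 : F != 0).
Local Notation R := {mpoly K[2]}.
Local Notation A := (gorenstein F_neq0).

HB.instance Definition _ := GRing.ComNzRing.on A.

Definition class : R -> A := \pi_{ideal_quot (annihilator F_neq0)}.

Lemma class_zmod : zmod_morphism class. Proof. exact: rmorphB. Qed.
Lemma class_monoid : monoid_morphism class.
Proof. by split; [exact: rmorph1 | exact: rmorphM]. Qed.
HB.instance Definition _ := GRing.isZmodMorphism.Build R A class class_zmod.
HB.instance Definition _ := GRing.isMonoidMorphism.Build R A class class_monoid.

Lemma classE f g : (class f == class g) = (contract (f - g) F == 0).
Proof. by rewrite /class -Quotient.idealrBE. Qed.

Definition lift (q : A) : R := repr (q : {ideal_quot (annihilator F_neq0)}).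
Lemma liftK : cancel lift class. Proof. exact: reprK. Qed.

Definition qscale (c : K) (q : A) : A := class c%:MP * q.
Fact qscaleA a b v : qscale a (qscale b v) = qscale (a * b) v.
Proof. by rewrite /qscale mulrA -rmorphM /= mpolyCM. Qed.
Fact qscale1 : left_id 1 qscale.
Proof. by move=> v; rewrite /qscale mpolyC1 rmorph1 mul1r. Qed.
Fact qscaleDr : right_distributive qscale +%R.
Proof. by move=> c u v; rewrite /qscale mulrDr. Qed.
Fact qscaleDl v : {morph qscale^~ v : a b / a + b}.
Proof. by move=> a b; rewrite /qscale mpolyCD rmorphD mulrDl. Qed.
HB.instance Definition _ :=
  GRing.Zmodule_isLmodule.Build K A qscaleA qscale1 qscaleDr qscaleDl.

Fact qscaleAl (c : K) (u v : A) : c *: (u * v) = (c *: u) * v.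
Proof. exact: mulrA. Qed.
HB.instance Definition _ := GRing.Lmodule_isLalgebra.Build K A qscaleAl.
Fact qscaleAr (c : K) (u v : A) : c *: (u * v) = u * (c *: v).
Proof. exact: mulrCA. Qed.
HB.instance Definition _ := GRing.Lalgebra_isAlgebra.Build K A qscaleAr.

Lemma class_scalable : scalable class.
Proof. by move=> c f; rewrite -mul_mpolyC rmorphM. Qed.
HB.instance Definition _ :=
  GRing.isScalable.Build K R A *:%R class class_scalable.

(* Well defined action of A on F, through any representative. *)
Definition act (q : A) : R := contract (lift q) F.

Lemma act_class f : act (class f) = contract f F.
Proof.
apply/eqP; rewrite -subr_eq0 /act -!/(contractl F _) -linearB.
by rewrite /contractl -classE liftK.
Qed.

Lemma act_linear : linear act.
Proof.
move=> c u v; rewrite -[u]liftK -[v]liftK -linearP !act_class.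
exact: contract_linearl.
Qed.
HB.instance Definition _ := GRing.isLinear.Build K A R _ act act_linear.

Lemma act_inj : injective act.
Proof.
move=> u v; rewrite -[u]liftK -[v]liftK !act_class => /eqP.
rewrite -subr_eq0 -!/(contractl F _) -linearB /contractl -classE.
by move/eqP.
Qed.

Let N := msize F.
Let W := {ffun 'X_{1..2 < N} -> K^o}.

Let coefs (q : A) : W := [ffun m : 'X_{1..2 < N} => (act q)@_m].
Let poly_of (w : W) : A := class (\sum_(m : 'X_{1..2 < N}) w m *: 'X_[m]).
Let trunc (q : A) : W := [ffun m : 'X_{1..2 < N} => (lift q)@_m].

Fact coefs_linear : linear coefs.
Proof.
by move=> c u v; apply/ffunP => m; rewrite !ffunE linearP mcoeffD mcoeffZ.
Qed.
HB.instance Definition _ := GRing.isLinear.Build K A W _ coefs coefs_linear.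

Fact poly_of_linear : linear poly_of.
Proof.
move=> c u v; rewrite /poly_of -linearP scaler_sumr -big_split /=.
congr class; apply: eq_bigr => m _.
by rewrite !ffunE scalerDl scalerA.
Qed.
HB.instance Definition _ :=
  GRing.isLinear.Build K W A _ poly_of poly_of_linear.

Lemma mderivm_msize0 m : (N <= mdeg m)%N -> F^`M[m] = 0.
Proof.
move=> le_N; apply/mpolyP => m'; rewrite mcoeff_mderivm mcoeff0.
rewrite memN_msupp_eq0 ?mul0rn //; apply/negP => /msize_mdeg_lt.
by rewrite mdegD ltnNge (leq_trans le_N) // leq_addr.
Qed.

Fact coefs_inj : injective coefs.
Proof.
move=> u v /ffunP eq_uv; apply: act_inj; apply/mpolyP => m.
have [lt_m|le_m] := ltnP (mdeg m) N.
  by have := eq_uv (BMultinom lt_m); rewrite !ffunE.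
suff act0 q : (act q)@_m = 0 by rewrite !act0.
rewrite /act /contract linear_sum big1 //= => m' _; rewrite mcoeffZ.
rewrite mcoeff_mderivm (@memN_msupp_eq0 _ _ F) ?mul0rn ?mulr0 //.
apply/negP => /msize_mdeg_lt; rewrite mdegD ltnNge (leq_trans le_m) //.
by rewrite leq_addl.
Qed.

Fact trunc_poly_of : cancel trunc poly_of.
Proof.
move=> q; rewrite -[RHS]liftK; apply/eqP; rewrite /poly_of classE.
rewrite -/(contractl F _) linearB subr_eq0 /= linear_sum /=.
under eq_bigr do rewrite linearZ /= /contractl contractX ffunE.
rewrite /contractl [contract _ _](bigID (fun m => mdeg m < N)%N) /=.
rewrite [X in _ + X]big1 => [|m]; last first.
  by rewrite -leqNgt => /mderivm_msize0 ->; rewrite scaler0.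
rewrite addr0 (big_mksub_cond 'X_{1..2 < N}) ?msupp_uniq //=.
rewrite [X in _ == X]big_rmcond //= => m; rewrite bmdeg /=.
by move=> /memN_msupp_eq0 ->; rewrite scale0r.
Qed.

HB.instance Definition _ := Lmodule_hasFinDim.Build K A
  (findim_vect_axiom trunc_poly_of coefs_inj).

(* A_i, the image of R_i in A. *)
Definition graded_part (i : nat) : {vspace A} :=
  limg (linfun (fun f : dhomog 2 K i => class f)).

(* The Hessian of F with respect to a family of elements of A: for a basis of
   A_i, this is the i-th Hessian. *)
Definition hessian n (alpha : n.-tuple A) : R :=
  \det (\matrix_(u < n, v < n) act (tnth alpha u * tnth alpha v)).

(* Multiplication by the class of f on A. *)
Definition mult (f : R) : 'End(A) := linfun (fun q : A => class f * q).

Lemma multE f q : mult f q = class f * q.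
Proof.
have lin : linear (fun q : A => class f * q).
  by move=> c u v; rewrite mulrDr scalerAr.
pose m : {linear A -> A} := HB.pack (fun q : A => class f * q)
  (GRing.isLinear.Build K A A _ _ lin).
exact: (lfunE m).
Qed.

Lemma memv_graded_part i (q : A) :
  reflect (exists2 f, f \is i.-homog & q = class f) (q \in graded_part i).
Proof.
have lin : linear (fun f : dhomog 2 K i => class f) by move=> c u v; rewrite /= linearP.
pose m : {linear dhomog 2 K i -> A} := HB.pack (fun f : dhomog 2 K i => class f)
  (GRing.isLinear.Build K (dhomog 2 K i) A _ _ lin).
have mE f : linfun (fun f : dhomog 2 K i => class f) f = class f by exact: (lfunE m).
apply: (iffP memv_imgP) => [[f _ ->]|[f hf ->]].
  by exists (f : R); rewrite ?mE // dhomog_is_dhomog.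
by exists (DHomog hf); rewrite ?memvf ?mE.
Qed.

End Algebra.

(* Block sizes of a nilpotent endomorphism f, in non-increasing order: the space
   has a basis made of strings z_u, f z_u, .., f^(p_u - 1) z_u with
   f^(p_u) z_u = 0, one for each Jordan block. *)
Definition jordan_type (K : fieldType) (V : vectType K) (f : 'End(V))
    (P : seq nat) : Prop :=
  [/\ sorted geq P, 0%N \notin P &
    exists z : nat -> V,
      (forall u, (u < size P)%N -> iter (nth 0%N P u) f (z u) = 0) /\
      basis_of fullv
        [seq iter s f (z u) | u <- iota 0 (size P), s <- iota 0 (nth 0%N P u)]].

(* The value at i of the sequence (1, 2, .., d-1, d^k, d-1, .., 2, 1), which is
   0 for i > j; here j = 2d + k - 3, and j + 1 - i is truncated subtraction. *)
Definition ci_hilbert (d k i : nat) : nat :=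
  if (i < d)%N then i.+1
  else if (i <= d + k - 2)%N then d
  else ((2 * d + k - 3).+1 - i)%N.

Definition linear_form (K : fieldType) (a b : K) : {mpoly K[2]} :=
  a *: 'X_ord0 + b *: 'X_ord_max.

(* Main.v *)
(* Put l = ax + by, T = j - 2i, and let r(v, s) be the rank of
   l^s : A_v -> A_(v+s), so that the rank of l^s on A is the sum of the r(v, s),
   and also the sum of the max(p_u - s, 0).  Since l^m o G = m! G(a, b) for a
   form G of degree m, h^i_l(F) is up to a nonzero factor the determinant of the
   form (q, q') |-> l^T q q' o F on A_i, so it is nonzero iff l^T is injective
   on A_i.
   The Hilbert function bounds r(v, T) by min(v + 1, 2i + 1 - v), hence the rank
   of l^T by (i + 1)^2, and p_1 + .. + p_(i+1) <= (i + 1) T + rank l^T.  If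
   l^T is not injective on A_i this is < (i + 1)(j + 1 - i).  Conversely, if it
   is injective, then so are l^T on A_v for v <= i and l^(T+1) on A_v for v < i,
   and duality gives the other ranks: rank l^T = (i + 1)^2 and
   rank l^(T+1) = i(i + 1).  Their difference i + 1 is the number of parts
   larger than T, so that p_1 + .. + p_(i+1) = (i + 1) T + rank l^T.
   For i = d - 1 the value d(d + k - 1) is dim A, which gives the number of
   parts. *)
From HB Require Import structures.
Require Import Defs.
From mathcomp Require Import all_boot all_order all_algebra zify.
From mathcomp.multinomials Require Import mpoly.

Set Implicit Arguments.
Unset Strict Implicit.
Unset Printing Implicit Defensive.

Import GRing.Theory.
Local Open Scope ring_scope.

(** * Partitions *)

Section Partitions.
Local Open Scope nat_scope.
Implicit Type P : seq nat.

(** Each part satisfies p <= T + (p - T), and the excesses of the omitted parts only enlarge the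
    right side; [nth] pads [P] with zeros. *)
Lemma sum_nth_le P m T :
  \sum_(u < m) nth 0 P u <= m * T + \sum_(p <- P) (p - T).
Proof.
elim: P m => [|p P IH] [|m]; rewrite ?big_ord0 //.
  by rewrite big1 // => u _; rewrite nth_nil.
rewrite big_ord_recl big_cons /=; have := IH m.
by rewrite (eq_bigr (fun u : 'I_m => nth 0 P u)) //; lia.
Qed.

(** Since (p - T) - (p - (T + 1)) is 1 for p > T and 0 otherwise, the hypothesis says that exactly
    [m] parts exceed [T]. Sortedness puts them first, so the bound of [sum_nth_le] is attained. *)
Lemma sum_nth_count P m T : sorted geq P ->
  \sum_(p <- P) (p - T) = \sum_(p <- P) (p - T.+1) + m ->
  m <= size P /\ \sum_(u < m) nth 0 P u = m * T + \sum_(p <- P) (p - T).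
Proof.
elim: P m => [|p P IH] m /=.
  by rewrite !big_nil => _; case: m => // _; rewrite big_ord0.
move=> sortP; rewrite !big_cons => eqm.
have [ltTp|lepT] := ltnP T p.
  case: m eqm => [|m] eqm.
    have: \sum_(q <- P) (q - T.+1) <= \sum_(q <- P) (q - T).
      by apply: leq_sum => q _; lia.
    lia.
  have [|le_m sum_m] := IH m (path_sorted sortP); first lia.
  split=> //; rewrite big_ord_recl /=.
  by rewrite (eq_bigr (fun u : 'I_m => nth 0 P u)) // sum_m; lia.
have P0 S : T <= S -> \sum_(q <- P) (q - S) = 0.
  move=> leTS; rewrite big_seq big1 // => q qP.
  have := order_path_min (rev_trans leq_trans) sortP.
  by move/allP/(_ q qP) => /=; lia.
move: eqm; rewrite !P0 // => eqm; have -> : m = 0 by lia.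
by rewrite big_ord0; split=> //; lia.
Qed.

(** For n = 2i + 1 and n = 2i the value is (i + 1)^2 and i(i + 1), the ranks expected of l^T and
    l^(T+1). The induction has step two: dropping both end terms, equal to 1, leaves the tent of
    length n raised by one. *)
Lemma sum_min_tent n :
  \sum_(v < n) minn v.+1 (n - v) = n.+1./2 * n./2.+1.
Proof.
suff [] : \sum_(v < n) minn v.+1 (n - v) = n.+1./2 * n./2.+1 /\
   \sum_(v < n.+1) minn v.+1 (n.+1 - v) = n.+2./2 * n.+1./2.+1 by [].
elim: n => [|n [IH1 IH2]]; first by rewrite big_ord0 big_ord1.
split=> //; rewrite big_ord_recl big_ord_recr /=.
rewrite (eq_bigr (fun v : 'I_n => 1 + minn v.+1 (n - v))); last first.
  by move=> v _ /=; rewrite /bump /=; have := ltn_ord v; lia.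
rewrite big_split /= sum1_card card_ord IH1 /=.
have := odd_double_half n; rewrite uphalf_half.
rewrite /bump /=.
case: (odd n); move: (n./2) => h; nia.
Qed.

Lemma ci_hilbertE d k v : 0 < d -> 0 < k ->
  ci_hilbert d k v = minn d (minn v.+1 ((2 * d + k - 3).+1 - v)).
Proof.
rewrite /ci_hilbert => d_gt0 k_gt0.
by have [?|?] := ltnP v d; have [?|?] := leqP v (d + k - 2); lia.
Qed.

(** Raising d by one lengthens the sequence by two: between two new end values 1 stand the old
    terms, each increased by one. *)
Lemma sum_ci_hilbert d k : 0 < d -> 0 < k ->
  \sum_(v < (2 * d + k - 3).+1) ci_hilbert d k v = d * (d + k - 1).
Proof.
move=> + k_gt0; case: d => // d _; elim: d => [|d IH].
  rewrite (eq_bigr (fun=> 1)) => [|v _]; first by rewrite sum1_card card_ord; lia.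
  by rewrite ci_hilbertE //; have := ltn_ord v; lia.
have -> : (2 * d.+2 + k - 3).+1 = (2 * d.+1 + k - 3).+3 by lia.
rewrite big_ord_recl big_ord_recr /=.
rewrite (eq_bigr (fun v : 'I_ _ => 1 + ci_hilbert d.+1 k v)) => [|v _].
  by rewrite big_split /= IH sum1_card card_ord !ci_hilbertE // /bump /=; nia.
by rewrite !ci_hilbertE //= /bump /=; have := ltn_ord v; lia.
Qed.

End Partitions.

(** * Ranks of powers of a nilpotent endomorphism *)

Section LinearAlgebra.
Variables (K : fieldType) (V : vectType K).

(** f^T shifts every string by T steps, so its image has as basis the f^s z_u with T <= s < p_u. *)
Lemma jordan_type_rank (f g : 'End(V)) P T :
  jordan_type f P -> g =1 iter T f ->
  \dim (limg g) = (\sum_(p <- P) (p - T))%N.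
Proof.
case=> _ _ [z [z0 basisB]] gE.
pose B' := [seq iter s f (z u) |
  u <- iota 0 (size P), s <- iota T (nth 0%N P u - T)].
have freeB' : free B'.
  have := basis_free basisB.
  (* Each string is cut at min(T, p_u), which leaves an empty tail for blocks shorter than T; the
     tails form a subfamily of a basis. *)
  rewrite (@eq_allpairsr _ _ _ (fun u s => iter s f (z u)) _ _
    (fun u => iota 0 (minn T (nth 0%N P u)) ++ iota T (nth 0%N P u - T))).
    rewrite (perm_free (introT permPl (perm_allpairs_catr _ _ _ _))).
    exact: catr_free.
  move=> u; have [le_T|lt_T] := leqP T (nth 0%N P u).
    by rewrite -[in LHS](subnKC le_T) iotaD.
  by rewrite (_ : (_ - _ = 0)%N) ?cats0 //; lia.
have -> : limg g = <<B'>>%VS.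
  rewrite -(span_basis basisB) limg_span; apply/subv_anti/andP; split.
    apply/span_subvP => _ /mapP[_ /allpairsPdep[u [s [uP sP ->]]] ->].
    rewrite gE -iterD; have [lt_s|ge_s] := ltnP (T + s) (nth 0%N P u).
      apply: memv_span; apply: (allpairs_f_dep (fun u s => iter s f (z u))) => //.
      by rewrite mem_iota; lia.
    move: uP; rewrite mem_iota add0n => uP.
    rewrite -(subnK ge_s) iterD z0 //.
    have -> : iter (T + s - nth 0%N P u) f 0 = 0.
      by elim: (_ - _)%N => //= n ->; rewrite linear0.
    exact: mem0v.
  apply/span_subvP => _ /allpairsPdep[u [s [uP sP ->]]].
  move: sP; rewrite mem_iota => sP; have -> : s = (T + (s - T))%N by lia.
  rewrite iterD -gE; apply/memv_span/map_f.
  apply: (allpairs_f_dep (fun u s => iter s f (z u))) => //.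
  by rewrite mem_iota; lia.
have /eqP -> := freeB'; rewrite size_allpairs_dep.
rewrite (eq_map (fun u => size_iota T _)).
by rewrite -[in RHS](mkseq_nth 0%N P) /mkseq big_map sumnE big_map.
Qed.

(** Rank-nullity on [U], where the kernel of [g] is contained in that of [f]. *)
Lemma dim_limg_le (W W' : vectType K) (f : 'Hom(V, W)) (g : 'Hom(V, W'))
    (U : {vspace V}) :
  {in U, forall x, g x = 0 -> f x = 0} -> (\dim (f @: U) <= \dim (g @: U))%N.
Proof.
move=> kerS; rewrite -(leq_add2l (\dim (U :&: lker f))) limg_ker_dim.
rewrite -(limg_ker_dim g U) leq_add2r dimvS //.
apply/subvP => x; rewrite !memv_cap !memv_ker => /andP[xU /eqP gx].
by rewrite xU (kerS x xU gx) eqxx.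
Qed.

Lemma limg_dim_eqP (W : vectType K) (f : 'Hom(V, W)) (U : {vspace V}) :
  reflect {in U, forall x, f x = 0 -> x = 0} (\dim (f @: U) == \dim U).
Proof.
rewrite -(limg_ker_dim f U) -[X in X == _]add0n eqn_add2r eq_sym dimv_eq0.
apply: (iffP eqP) => [cap0 x xU fx|inj].
  by apply/eqP; rewrite -memv0 -cap0 memv_cap memv_ker xU fx eqxx.
apply/eqP; rewrite -subv0; apply/subvP => x.
by rewrite memv_cap memv_ker memv0 => /andP[xU /eqP fx]; rewrite (inj x xU fx).
Qed.

End LinearAlgebra.

(** * Contraction of binary forms *)

Section Contraction.
Variable K : fieldType.
Implicit Types f g G : {mpoly K[2]}.

Lemma mderivm_homog n G m : G \is n.-homog ->
  G^`M[m] \is (n - mdeg m).-homog.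
Proof.
move=> homG; apply/dhomogP => m'; rewrite mcoeff_msupp mcoeff_mderivm => nz.
have: (m + m')%MM \in msupp G.
  by rewrite mcoeff_msupp; apply: contra nz => /eqP ->; rewrite mul0rn.
by move/(dhomog_mf homG) => /= <-; rewrite mdegD addKn.
Qed.

Lemma contract_homog i n f G : f \is i.-homog -> G \is n.-homog ->
  contract f G \is (n - i).-homog.
Proof.
move=> homf homG; rewrite /contract big_seq rpred_sum // => m mf.
by rewrite rpredZ // -((dhomog_mf homf) m mf) mderivm_homog.
Qed.

Lemma contract_homog_gt i n f G : f \is i.-homog -> G \is n.-homog ->
  (n < i)%N -> contract f G = 0.
Proof.
move=> homf homG lt_ni; rewrite /contract big_seq big1 // => m mf.
apply/mpolyP => m'; rewrite mcoeffZ mcoeff_mderivm mcoeff0.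
rewrite (dhomog_nemf_coeff homG) ?mul0rn ?mulr0 //.
rewrite /= mdegD; have /= := (dhomog_mf homf) m mf; lia.
Qed.

Lemma homog0_eq0 G : G \is 0.-homog -> G@_0 = 0 -> G = 0.
Proof.
move=> homG G0; apply/mpolyP => m; rewrite mcoeff0.
have [->//|nz] := eqVneq m 0%MM.
by rewrite (dhomog_nemf_coeff homG) // mdeg_eq0.
Qed.

(** Contraction with the monomial of exponent m extracts the coefficient of G at m, times a product
    of factorials that is nonzero in characteristic 0. *)
Lemma contract_nondegenerate (char0 : [pchar K] =i pred0) n G :
  G \is n.-homog -> (forall f, f \is n.-homog -> contract f G = 0) -> G = 0.
Proof.
move=> homG G0; apply/mpolyP => m; rewrite mcoeff0.
have [degm|nz] := eqVneq (mdeg m) n; last exact: dhomog_nemf_coeff nz.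
have homm : ('X_[m] : {mpoly K[2]}) \is n.-homog by rewrite dhomogX /= degm.
have /(congr1 (mcoeff 0%MM)) := G0 _ homm.
rewrite contractX mcoeff_mderivm addm0 mcoeff0.
rewrite -mulr_natr => /eqP; rewrite mulf_eq0 => /orP[/eqP//|].
rewrite ((pcharf0P K).1 char0) => /idPn[]; rewrite -lt0n prodn_gt0 // => i.
by rewrite ffactnn fact_gt0.
Qed.

Lemma euler_homog n G : G \is n.-homog ->
  \sum_(i < 2) 'X_i * G^`M(i) = n%:R *: G.
Proof.
move=> homG; rewrite [G in LHS]mpolyE [G in RHS]mpolyE scaler_sumr.
under eq_bigr do rewrite linear_sum mulr_sumr.
rewrite exchange_big /= !big_seq; apply: eq_bigr => m mG.
rewrite -((dhomog_mf homG) m mG) /= mdegE natr_sum scaler_suml.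
apply: eq_bigr => i _; rewrite linearZ /= mderivX.
have [->|nz] := eqVneq (m i) 0%N; first by rewrite !scale0r scaler0 mulr0.
by rewrite -!scalerAr -mpolyXD addmC submK ?lep1mP // scalerA mulrC -scalerA.
Qed.

Variables a b : K.
Local Notation l := (linear_form a b).
Local Notation pt := (tnth [tuple a; b]).

Lemma linear_form_homog s : l ^+ s \is s.-homog.
Proof.
rewrite -[s in s.-homog]mul1n; apply: dhomogMn.
by rewrite rpredD // rpredZ // dhomogX /= mdeg1.
Qed.

Lemma contract_linear_form G :
  contract l G = a *: G^`M(ord0) + b *: G^`M(ord_max).
Proof.
rewrite -[LHS]/(contractl G l) /linear_form linearD !linearZ /= /contractl.
by rewrite !contractX !mderivmU1m.
Qed.

(** Peel off one factor l: by Euler's identity at (a, b), the form l o G of degree n takes the value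
    (n + 1) G(a, b) there. *)
Lemma contract_linear_form_exp n G : G \is n.-homog ->
  contract (l ^+ n) G = (n`!%:R * G.@[pt])%:MP.
Proof.
elim: n G => [|n IH] G homG.
  rewrite expr0 contract1 mul1r; apply/eqP; rewrite -subr_eq0; apply/eqP.
  have -> : G = (G@_0)%:MP.
    apply/eqP; rewrite -subr_eq0; apply/eqP/homog0_eq0.
      by rewrite rpredB // -[_%:MP]mulr1 mul_mpolyC rpredZ // dhomog1.
    by rewrite mcoeffB mcoeffC eqxx mulr1 subrr.
  by rewrite mevalC subrr.
rewrite exprSr contractM; have homlG : contract l G \is n.-homog.
  by have := contract_homog (linear_form_homog 1) homG; rewrite expr1 subn1.
rewrite IH //; congr (_%:MP); rewrite factS natrM mulrAC [_ * n`!%:R]mulrC.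
congr (_ * _).
have /(congr1 (meval pt)) := euler_homog homG.
rewrite mevalZ big_ord_recl big_ord1 mevalD !mevalM !mevalXU => <-.
rewrite contract_linear_form mevalD !mevalZ.
by rewrite (_ : lift ord0 ord0 = ord_max) //; apply: val_inj.
Qed.

End Contraction.

(** * Duality and Hessians *)

Section Gorenstein.
Variables (K : fieldType) (char0 : [pchar K] =i pred0).
Variables (j : nat) (F : {mpoly K[2]}) (F_neq0 : F != 0).
Hypothesis F_homog : F \is j.-homog.
Local Notation A := (gorenstein F_neq0).
Local Notation A_ := (graded_part F_neq0).
Local Notation class := (@class K F F_neq0).
Local Notation mult := (@mult K F F_neq0).
Implicit Types (f g : {mpoly K[2]}) (q x : A).

Lemma act_mul f q : act (class f * q) = contract f (act q).
Proof. by rewrite -[q]Defs.liftK -rmorphM !act_class contractM. Qed.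

Lemma act_homog v q : q \in A_ v -> act q \is (j - v).-homog.
Proof.
by move=> /memv_graded_part[f homf ->]; rewrite act_class contract_homog.
Qed.

Lemma act_socle x : x \in A_ j -> (act x)@_0 = 0 -> act x = 0.
Proof. by move=> /act_homog; rewrite subnn; apply: homog0_eq0. Qed.

Lemma class_graded v f : f \is v.-homog -> class f \in A_ v.
Proof. by move=> homf; apply/memv_graded_part; exists f. Qed.

Lemma graded_mul u v q x : q \in A_ u -> x \in A_ v -> q * x \in A_ (u + v).
Proof.
move=> /memv_graded_part[f homf ->] /memv_graded_part[g homg ->].
by rewrite -rmorphM class_graded // dhomogM.
Qed.

Lemma graded_part_gt v : (j < v)%N -> A_ v = 0%VS.
Proof.
move=> lt_jv; apply/eqP; rewrite -subv0; apply/subvP => q.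
case/memv_graded_part => f homf ->; rewrite memv0; apply/eqP/act_inj.
by rewrite act_class (contract_homog_gt homf F_homog lt_jv) linear0.
Qed.

Lemma graded_nondegenerate v q : q \in A_ v ->
  (forall x, x \in A_ (j - v) -> act (x * q) = 0) -> q = 0.
Proof.
move=> qA q0; apply: act_inj; rewrite linear0.
apply: (contract_nondegenerate char0 (act_homog qA)) => f homf.
by rewrite -act_mul q0 // class_graded.
Qed.

(** [act] sends the summands to forms of degrees j - e v. These are distinct because [e] is
    injective and bounded by [j], so that no subtraction is truncated. *)
Lemma graded_independent n (e : 'I_n -> nat) (us : 'I_n -> A) :
  injective e -> (forall v, (e v <= j)%N) -> (forall v, us v \in A_ (e v)) ->
  \sum_v us v = 0 -> forall v, us v = 0.
Proof.
move=> e_inj e_le usA us0 v; apply: act_inj; rewrite linear0.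
have: pihomog mdeg (j - e v) (\sum_u act (us u)) = 0.
  by rewrite -linear_sum us0 linear0 pihomog0.
rewrite linear_sum (bigD1 v) //= big1 ?addr0 => [|u ne_uv].
  by rewrite pihomog_dE // act_homog.
rewrite (pihomog_ne0 _ (act_homog (usA u))) //.
apply: contra ne_uv => /eqP eq_uv; apply/eqP/e_inj.
by have := e_le u; have := e_le v; lia.
Qed.

Lemma graded_sum : (\sum_(v < j.+1) (A_ v))%VS = fullv.
Proof.
apply/eqP; rewrite eqEsubv subvf /=; apply/subvP => q _.
rewrite -[q]Defs.liftK (pihomog_partitionE (leqnn (msize (Defs.lift q)))).
rewrite linear_sum /=.
apply: memv_suml => v _; have piA := class_graded (pihomogP mdeg v (Defs.lift q)).
have [le_vj|lt_jv] := leqP v j; last first.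
  by move: piA; rewrite graded_part_gt // memv0 => /eqP ->; apply: mem0v.
by apply: subvP piA; apply: (sumv_sup (Ordinal (le_vj : v < j.+1)%N)).
Qed.

Lemma limg_mult_graded s v f : f \is s.-homog ->
  (mult f @: A_ v <= A_ (s + v))%VS.
Proof.
move=> homf; apply/subvP => _ /memv_imgP[q qA ->]; rewrite Defs.multE.
by rewrite graded_mul // class_graded.
Qed.

(** The images of the A_v lie in distinct degrees s + v, hence are independent; those with s + v > j
    vanish, which cuts off the sum. *)
Lemma dim_limg_mult s f : f \is s.-homog ->
  \dim (limg (mult f)) = (\sum_(v < j.+1 - s) \dim (mult f @: A_ v))%N.
Proof.
move=> homf; rewrite -graded_sum limg_sum.
have -> : (\sum_(v < j.+1) mult f @: A_ v =
           \sum_(v < j.+1 - s) mult f @: A_ v)%VS.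
  apply/subv_anti/andP; split; apply/subv_sumP => v _.
    have [lt_v|le_v] := ltnP v (j.+1 - s).
      exact: (sumv_sup (Ordinal lt_v)).
    apply: subv_trans (limg_mult_graded v homf) _.
    by rewrite graded_part_gt ?sub0v //; lia.
  exact: (sumv_sup (widen_ord (leq_subr s j.+1) v)).
apply/directvP/directv_sum_independent => us usA us0 v _.
apply: (@graded_independent _ (fun v : 'I__ => s + v)%N us) => //.
- by move=> u w /addnI /val_inj.
- by move=> u; have := ltn_ord u; lia.
by move=> u; apply: subvP (usA u isT); apply: limg_mult_graded.
Qed.

(* Multiplication by [f] on [(A_ w)] and on [(A_ v)] are transposes of each other
   for the perfect pairings [A_i * A_ (j - i) -> K]. *)
Lemma dim_limg_mult_dual s v w f : f \is s.-homog -> (w + s + v = j)%N ->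
  (\dim (mult f @: (A_ w)) <= \dim (mult f @: A_ v))%N.
Proof.
move=> homf eqj; set U := (mult f @: A_ v)%VS.
(* [phi] pairs q with a basis of f A_v. Its rank is at most dim U, so it suffices that f q = 0
   whenever q in A_w has [phi q = 0]. *)
pose phi q : 'rV[K]_(\dim U) := \row_t (act (q * (vbasis U)`_t))@_0.
have phi_linear : linear phi.
  move=> c x y; apply/rowP => t; rewrite !mxE mulrDl -scalerAl linearP.
  by rewrite mcoeffD mcoeffZ.
pose phiL : {linear A -> 'rV[K]_(\dim U)} := HB.pack phi
  (GRing.isLinear.Build K A _ _ phi phi_linear).
apply: leq_trans (dim_limg_le (g := linfun phiL) _) _; last first.
  by apply: leq_trans (dimvS (subvf _)) _; rewrite dimvf /dim /= mul1n.
move=> q qA; rewrite lfunE /= => phi0; rewrite Defs.multE.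
have homfq : class f * q \in A_ (s + w) by rewrite graded_mul ?class_graded.
apply: (graded_nondegenerate homfq) => x.
rewrite (_ : j - (s + w) = v)%N => [xA|]; last lia.
(* Pairing f q with x is pairing q with f x, which lies in [U], where [phi q = 0] applies. *)
have yU : class f * x \in U by rewrite -Defs.multE memv_img.
rewrite mulrA mulrC [x * _]mulrC; apply: act_socle.
  by rewrite -eqj -addnA !graded_mul ?class_graded.
rewrite (coord_vbasis yU) mulr_sumr [act _]linear_sum [mcoeff _ _]raddf_sum.
rewrite big1 //= => t _; rewrite -scalerAr [act (_ *: _)]linearZ mcoeffZ.
by have /rowP/(_ t) := phi0; rewrite !mxE => ->; rewrite mulr0.
Qed.

(** The forms of degree n have dimension n + 1, so they map injectively onto A_n. *)
Lemma class_inj_homog n f : \dim (A_ n) = n.+1 -> f \is n.-homog ->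
  class f = 0 -> f = 0.
Proof.
move=> dimA homf f0; pose h : 'Hom(dhomog 2 K n, A) :=
  linfun (fun g : dhomog 2 K n => class g).
have lin : linear (fun g : dhomog 2 K n => class g).
  by move=> c g g'; rewrite /= linearP.
pose m : {linear dhomog 2 K n -> A} := HB.pack
  (fun g : dhomog 2 K n => class g)
  (GRing.isLinear.Build K (dhomog 2 K n) A _ _ lin).
have hE (g : dhomog 2 K n) : h g = class g by exact: (lfunE m).
have /limg_dim_eqP inj : \dim (h @: fullv) == \dim {:dhomog 2 K n}.
  rewrite -[(h @: fullv)%VS]/(A_ n) dimA dimvf.
  by rewrite (_ : dim _ = 'C(n + 1, n)) // addn1 binSn.
have hf0 : h (DHomog homf) = 0 by rewrite hE.
by have /(congr1 val) := inj _ (memvf _) hf0.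
Qed.

(** In degree s + u the algebra A coincides with the polynomial ring, which is a domain. *)
Lemma mult_inj_low s u f : f != 0 -> f \is s.-homog ->
  \dim (A_ (s + u)%N) = (s + u).+1 ->
  {in A_ u, forall q, mult f q = 0 -> q = 0}.
Proof.
move=> f_neq0 homf dimA q /memv_graded_part[g homg ->].
rewrite Defs.multE -rmorphM => /(class_inj_homog dimA (dhomogM homf homg)) /eqP.
by rewrite mulf_eq0 (negPf f_neq0) => /eqP ->; rewrite linear0.
Qed.

Variables a b : K.
Local Notation l := (linear_form a b).
Local Notation pt := (tnth [tuple a; b]).

Lemma mult_expE s : mult (l ^+ s) =1 iter s (mult l).
Proof.
elim: s => [|s IH] q; first by rewrite Defs.multE expr0 rmorph1 mul1r.
by rewrite iterS -IH !Defs.multE exprS rmorphM mulrA.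
Qed.

Lemma meval_act v x : x \in A_ v ->
  (j - v)`!%:R * (act x).@[pt] = (act (class (l ^+ (j - v)) * x))@_0.
Proof.
move=> xA; rewrite act_mul (contract_linear_form_exp _ _ (act_homog xA)).
by rewrite mcoeffC eqxx mulr1.
Qed.

Lemma hessian_neq0P i (alpha : i.+1.-tuple A) : (2 * i <= j)%N ->
  basis_of (A_ i) alpha ->
  reflect {in (A_ i), forall q, mult (l ^+ (j - 2 * i)) q = 0 -> q = 0}
          ((hessian alpha).@[pt] != 0).
Proof.
move=> le_ij basA; set T := (j - 2 * i)%N.
pose M := \matrix_(u < i.+1, v < i.+1)
  (act (tnth alpha u * tnth alpha v)).@[pt].
have -> : (hessian alpha).@[pt] = \det M.
  rewrite /hessian -det_map_mx; congr (\det _).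
  by apply/matrixP => u v; rewrite !mxE.
have alphaA u : tnth alpha u \in A_ i by rewrite (basis_mem basA) ?mem_tnth.
(* Up to T!, [M] is the Gram matrix of (q, q') -> l^T q q' o F: the products q q' lie in A_(2i), and
   T = j - 2i is the degree left to evaluate by l^T. *)
have ME (c : 'rV_i.+1) (q := \sum_u c 0 u *: tnth alpha u) v :
    T`!%:R * (c *m M) 0 v = (act (mult (l ^+ T) q * tnth alpha v))@_0.
  rewrite Defs.multE -mulrA /T mul2n -addnn -meval_act; last first.
    by rewrite graded_mul // memv_suml // => u _; rewrite memvZ.
  congr (_ * _); rewrite mxE mulr_suml [act _]linear_sum [meval _ _]raddf_sum.
  by apply: eq_bigr => u _; rewrite mxE -scalerAl /= [act (_ *: _)]linearZ mevalZ.
have qE q : q \in A_ i -> exists c : 'rV_i.+1, q = \sum_u c 0 u *: tnth alpha u.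
  move=> /(coord_basis basA) {1}->; exists (\row_u coord alpha u q).
  by apply: eq_bigr => u _; rewrite mxE (tnth_nth 0).
apply: (iffP idP) => [detM q /qE[c ->] lq0|inj].
  have cM0 : c *m M = 0.
    apply/rowP => v; rewrite [RHS]mxE; have := ME c v.
    rewrite lq0 mul0r linear0 mcoeff0.
    move/eqP; rewrite mulf_eq0 ((pcharf0P K).1 char0) => /orP[|/eqP//].
    by rewrite eqn0Ngt fact_gt0.
  have uM : M \in unitmx by rewrite unitmxE unitfE.
  have /= := congr1 (mulmx^~ (invmx M)) cM0; rewrite mulmxK // mul0mx => ->.
  by rewrite big1 // => u _; rewrite mxE scale0r.
apply/negP => /det0P[c c_neq0 cM0].
pose q := \sum_u c 0 u *: tnth alpha u.
have qA : q \in A_ i by rewrite memv_suml // => u _; rewrite memvZ.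
(* A left kernel vector of [M] makes l^T q orthogonal to A_i. Its degree T + i is complementary to
   i, so l^T q = 0 by nondegeneracy. *)
have q0 : q = 0.
  apply: inj => //; have lqA : mult (l ^+ T) q \in A_ (T + i).
    by rewrite Defs.multE graded_mul ?class_graded ?linear_form_homog.
  apply: (graded_nondegenerate lqA) => x.
  rewrite (_ : j - (T + i) = i)%N => [xA|]; last by rewrite /T; lia.
  apply: act_socle.
    have {1}-> : j = (i + (T + i))%N by rewrite /T; lia.
    by rewrite graded_mul.
  rewrite (coord_basis basA xA) mulr_suml [act _]linear_sum.
  rewrite [mcoeff _ _]raddf_sum big1 //= => u _.
  rewrite -scalerAl [act (_ *: _)]linearZ /= mcoeffZ.
  rewrite [alpha`_u * _]mulrC -tnth_nth -ME.
  by rewrite cM0 mxE !mulr0.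
case/negP: c_neq0; apply/eqP/rowP => u; rewrite [RHS]mxE.
have /freeP indep := basis_free basA; apply: (indep (fun u => c 0 u)).
by rewrite -[RHS]q0; apply: eq_bigr => v _; rewrite (tnth_nth 0).
Qed.

End Gorenstein.

(** * Jordan type and Hessians *)

Section JordanHessian.
Variables (K : fieldType) (char0 : [pchar K] =i pred0).
Variables (d k j : nat) (d_gt0 : (0 < d)%N) (k_gt0 : (0 < k)%N).
Hypothesis jE : j = (2 * d + k - 3)%N.
Variables (F : {mpoly K[2]}) (F_neq0 : F != 0) (F_homog : F \is j.-homog).
Local Notation A_ := (graded_part F_neq0).
Hypothesis hilbA : forall i, \dim (A_ i) = ci_hilbert d k i.
Variables (a b : K).
Local Notation l := (linear_form a b).
Local Notation mult := (@mult K F F_neq0).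
Hypothesis l_neq0 : l != 0.

Lemma dim_graded_low i : (i < d)%N -> \dim (A_ i) = i.+1.
Proof. by rewrite hilbA /ci_hilbert => ->. Qed.

Lemma dim_graded_le v : (\dim (A_ v) <= minn v.+1 (j.+1 - v))%N.
Proof. by rewrite hilbA ci_hilbertE //; lia. Qed.

Lemma dim_limg_graded_le s v :
  (\dim (mult (l ^+ s) @: A_ v) <= minn v.+1 (j.+1 - s - v))%N.
Proof.
have le_v : (\dim (mult (l ^+ s) @: A_ v) <= \dim (A_ v))%N.
  by rewrite -(limg_ker_dim (mult (l ^+ s)) (A_ v)) leq_addl.
have le_sv := dimvS (limg_mult_graded F_neq0 v (linear_form_homog a b s)).
move: (leq_trans le_v (dim_graded_le v)).
by move: (leq_trans le_sv (dim_graded_le (s + v))); lia.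
Qed.

Section Index.
Variables (i : nat) (lt_id : (i < d)%N).
Local Notation T := (j - 2 * i)%N.

Lemma double_index_le : (2 * i <= j)%N. Proof. by lia. Qed.

Lemma rank_lt : (\dim (mult (l ^+ T) @: A_ i) < i.+1)%N ->
  (\dim (limg (mult (l ^+ T))) < i.+1 ^ 2)%N.
Proof.
move=> lt_r; rewrite (dim_limg_mult F_neq0 F_homog (linear_form_homog a b T)).
have nE : (j.+1 - T = i.*2.+1)%N by have := double_index_le; lia.
have : (\sum_(v < j.+1 - T) minn v.+1 (j.+1 - T - v) = i.+1 * i.+1)%N.
  by rewrite sum_min_tent nE /= uphalf_double doubleK.
have lt_i : (i < j.+1 - T)%N by have := double_index_le; lia.
(* Isolate v = i, the peak of the tent with value i + 1: the deficit there is strict and no other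
   term can compensate it. *)
rewrite (bigD1 (Ordinal lt_i)) // [X in (X < _)%N](bigD1 (Ordinal lt_i)) //=.
have : (\sum_(v < j.+1 - T | v != Ordinal lt_i) \dim (mult (l ^+ T) @: A_ v) <=
  \sum_(v < j.+1 - T | v != Ordinal lt_i) minn v.+1 (j.+1 - T - v))%N.
  by apply: leq_sum => v _; apply: dim_limg_graded_le.
rewrite -mulnn; move: lt_r.
by move: (\sum_(v < _ | _) minn _ _)%N (\sum_(v < _ | _) _)%N (\dim _); lia.
Qed.

Hypothesis injT : {in A_ i, forall q, mult (l ^+ T) q = 0 -> q = 0}.

(** l^(i-u) embeds A_u into A_i, where l^T is injective; u + e <= i makes the composite l^(T+i-u) a
    multiple of l^(T+e). *)
Lemma dim_limg_graded_low e u : (u + e <= i)%N ->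
  \dim (mult (l ^+ (T + e)) @: A_ u) = u.+1.
Proof.
move=> le_i; rewrite -(@dim_graded_low u); last lia.
apply/eqP/limg_dim_eqP => q qA; rewrite Defs.multE => lq0.
have eq_i : (i - u + u = i)%N by lia.
apply: (mult_inj_low (f := l ^+ (i - u)) _ _ _ qA).
- by rewrite expf_neq0.
- exact: linear_form_homog.
- by rewrite eq_i dim_graded_low.
apply: injT.
  rewrite Defs.multE -[i in A_ i]eq_i graded_mul ?class_graded //.
  exact: linear_form_homog.
rewrite !Defs.multE mulrA -rmorphM -exprD.
rewrite (_ : T + (i - u) = (i - u - e) + (T + e))%N; last lia.
by rewrite exprD rmorphM -mulrA lq0 mulr0.
Qed.

Lemma rank_eq e : (e <= 1)%N ->
  \dim (limg (mult (l ^+ (T + e)))) =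
  (\sum_(v < j.+1 - (T + e)) minn v.+1 (j.+1 - (T + e) - v))%N.
Proof.
move=> le_e; have le_ij := double_index_le.
rewrite (dim_limg_mult F_neq0 F_homog (linear_form_homog a b (T + e))).
apply: eq_bigr => v _; have lt_v := ltn_ord v.
apply/eqP; rewrite eqn_leq dim_limg_graded_le /=.
have [le_vi|lt_iv] := leqP (v + e) i.
  by rewrite dim_limg_graded_low //; lia.
(* The dual degree: w + (T + e) + v = j. As e <= 1, v + e > i gives v >= i, hence w + e <= i and
   [dim_limg_graded_low] applies to w. *)
pose w := (2 * i - e - v)%N.
apply: leq_trans (dim_limg_mult_dual (w := w) char0 F_neq0 F_homog
  (linear_form_homog a b (T + e)) _); last by rewrite /w; lia.
by rewrite dim_limg_graded_low /w; lia.
Qed.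

End Index.

Variable P : seq nat.
Hypothesis jtP : jordan_type (mult l) P.

Lemma rank_jordan s :
  \dim (limg (mult (l ^+ s))) = (\sum_(p <- P) (p - s))%N.
Proof. by apply: jordan_type_rank jtP _; apply: mult_expE. Qed.

Lemma sum_parts_low i : (i < d)%N ->
  {in A_ i, forall q, mult (l ^+ (j - 2 * i)) q = 0 -> q = 0} ->
  (i < size P)%N /\ (\sum_(u < i.+1) nth 0 P u = i.+1 * (j.+1 - i))%N.
Proof.
move=> lt_id injT; have le_ij := double_index_le lt_id; case: jtP => sortP _ _.
have r0 := rank_eq lt_id injT (leq0n 1); have r1 := rank_eq lt_id injT (leqnn 1).
move: r0 r1; rewrite addn0 addn1 !rank_jordan !sum_min_tent.
rewrite (_ : j.+1 - (j - 2 * i) = i.*2.+1)%N; last lia.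
rewrite (_ : j.+1 - (j - 2 * i).+1 = i.*2)%N; last lia.
rewrite /= doubleK uphalf_double => r0 r1.
have [|le_m ->] := @sum_nth_count P i.+1 (j - 2 * i) sortP.
  by rewrite r0 ?r1; lia.
by split=> //; rewrite r0; nia.
Qed.

Lemma sum_parts_lt i : (i < d)%N ->
  (\dim (mult (l ^+ (j - 2 * i)) @: A_ i) < i.+1)%N ->
  (\sum_(u < i.+1) nth 0 P u < i.+1 * (j.+1 - i))%N.
Proof.
move=> lt_id lt_r; have le_ij := double_index_le lt_id.
have := rank_lt lt_id lt_r; rewrite rank_jordan.
by have := sum_nth_le P i.+1 (j - 2 * i); nia.
Qed.

Lemma sum_parts : (\sum_(p <- P) p = d * (d + k - 1))%N.
Proof.
(* The sum of the parts is read as the rank of l^0, the identity, which is dim A. *)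
have <- : (\sum_(p <- P) (p - 0) = \sum_(p <- P) p)%N.
  by apply: eq_bigr => p _; rewrite subn0.
rewrite -rank_jordan expr0 (dim_limg_mult F_neq0 F_homog (dhomog1 _ _)).
rewrite subn0 -sum_ci_hilbert // -jE; apply: eq_bigr => v _; rewrite -hilbA.
by apply/eqP/limg_dim_eqP => q _; rewrite Defs.multE rmorph1 mul1r.
Qed.

Lemma hessian_neq0_injP i (alpha : i.+1.-tuple (gorenstein F_neq0)) :
  (i < d)%N -> basis_of (A_ i) alpha ->
  reflect {in A_ i, forall q, mult (l ^+ (j - 2 * i)) q = 0 -> q = 0}
          ((hessian alpha).@[tnth [tuple a; b]] != 0).
Proof.
by move=> lt_id; apply: hessian_neq0P => //; apply: double_index_le.
Qed.

Lemma hessian_sum_parts i (alpha : i.+1.-tuple (gorenstein F_neq0)) :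
  (i < d)%N -> basis_of (A_ i) alpha ->
  (hessian alpha).@[tnth [tuple a; b]] != 0 <->
  (\sum_(u < i.+1) nth 0 P u = i.+1 * (j.+1 - i))%N.
Proof.
move=> lt_id basA; split=> [/(hessian_neq0_injP lt_id basA) injT|sumP].
  by have [] := sum_parts_low lt_id injT.
apply/(hessian_neq0_injP lt_id basA)/limg_dim_eqP.
rewrite dim_graded_low // eqn_leq -{1}(@dim_graded_low i) //.
rewrite -[X in (_ <= X)%N](limg_ker_dim (mult (l ^+ (j - 2 * i)))) leq_addl /=.
by rewrite leqNgt; apply/negP => /(sum_parts_lt lt_id); rewrite sumP ltnn.
Qed.

(** At i = d - 1 the Hessian criterion says that the first d parts already sum to dim A.
    Nonvanishing also yields at least d parts, and a further one, being positive, would exceed the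
    total. *)
Lemma hessian_size_parts m (alpha : m.+1.-tuple (gorenstein F_neq0)) :
  d = m.+1 -> basis_of (A_ m) alpha ->
  size P = d <-> (hessian alpha).@[tnth [tuple a; b]] != 0.
Proof.
move=> dE basA; have lt_md : (m < d)%N by rewrite dE.
have sumE : (m.+1 * (j.+1 - m) = \sum_(0 <= u < size P) nth 0 P u)%N.
  have := sum_parts; rewrite (big_nth 0%N) => ->.
  by rewrite dE; congr (_ * _)%N; lia.
have hess := hessian_sum_parts lt_md basA; split=> [sizeP|nz].
  by apply/hess; rewrite sumE sizeP dE big_mkord.
have [lt_mP _] := sum_parts_low lt_md (elimT (hessian_neq0_injP lt_md basA) nz).
have := hess.1 nz; rewrite sumE dE => sum_m.
apply/eqP; rewrite eqn_leq lt_mP andbT leqNgt; apply/negP => lt_mP1.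
have /negP[] : 0%N \notin P by case: jtP.
move: sum_m; rewrite (big_cat_nat (n := m.+1)) //= big_mkord big_ltn //.
move: (mem_nth 0%N lt_mP1).
by case: (nth 0 P m.+1)%N => // p _ /eqP; rewrite -[X in X == _]addn0 eqn_add2l.
Qed.

End JordanHessian.

Unset Implicit Arguments.

Theorem theorem3p6 (K : fieldType) (char0 : [pchar K] =i pred0)
    (d k j : nat) (d_gt0 : (0 < d)%N) (k_gt0 : (0 < k)%N)
    (jE : j = (2 * d + k - 3)%N)
    (F : {mpoly K[2]}) (F_neq0 : F != 0) (F_homog : F \is j.-homog)
    (hilbA : forall i : nat, \dim (graded_part F_neq0 i) = ci_hilbert d k i)
    (a b : K) (l_neq0 : linear_form a b != 0)
    (P : seq nat) (jtP : jordan_type (mult F_neq0 (linear_form a b)) P) :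
  (forall i : nat, (i < d)%N ->
     (i.+1 * (2 * d + k - i - 2) = i.+1 * (j + 1 - i))%N /\
     forall alpha : i.+1.-tuple (gorenstein F_neq0),
       basis_of (graded_part F_neq0 i) alpha ->
       ((hessian alpha).@[tnth [tuple a; b]] != 0 <->
        (\sum_(u < i.+1) nth 0 P u = i.+1 * (2 * d + k - i - 2))%N))
  /\
  (forall alpha : d.-tuple (gorenstein F_neq0),
     basis_of (graded_part F_neq0 d.-1) alpha ->
     (size P = d <->
      ~ ((2 <= k)%N /\ (hessian alpha).@[tnth [tuple a; b]] = 0))).
Proof.
split=> [i lt_id|].
  have eq_j : (2 * d + k - i - 2 = j.+1 - i)%N by lia.
  rewrite addn1 eq_j; split=> // alpha basA.
  exact: (hessian_sum_parts char0 d_gt0 k_gt0 jE F_homog hilbA l_neq0 jtP).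
case dE : d => [|m]; first by rewrite dE in d_gt0.
move=> alpha basA.
have := hessian_size_parts char0 d_gt0 k_gt0 jE F_homog hilbA l_neq0 jtP dE basA.
rewrite {1}dE => ->.
split=> [/eqP nz [_ /nz]//|nz]; apply/eqP => h0; apply: nz; split=> //.
(* For [k = 1], [j - 2 (d - 1) = 0] and the top Hessian never vanishes. *)
rewrite ltnNge; apply/negP => le_k1; move/eqP: h0; apply/negP.
have le_mj : (2 * m <= j)%N by lia.
apply/(hessian_neq0P char0 F_homog a b le_mj basA).
move=> q _; rewrite (_ : j - 2 * m = 0)%N; last by lia.
by rewrite Defs.multE expr0 rmorph1 mul1r.
Qed.
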